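(* Let $M=(\mathcal{S},\mathcal{X},\mathcal{T},\mathcal{O})$ be an irreducible (finite) state-emitting hidden Markov model that is path-mergeable. Then the entropy rate block estimates $h(t)$ of its stationary output process converge exponentially to the entropy rate $h$, i.e. $\limsup_{t\to\infty}\{h(t)-h\}^{1/t}<1$.
   Context: State-emitting HMM: a 4-tuple $(\mathcal{S},\mathcal{X},\mathcal{T},\mathcal{O})$ with $\mathcal{S}$ a finite set of states, $\mathcal{X}$ a finite alphabet, $\mathcal{T}$ an $|\mathcal{S}|\times|\mathcal{S}|$ stochastic matrix, $\mathcal{T}_{ij}=\mathbb{P}(S_{t+1}=j\mid S_t=i)$, and $\mathcal{O}$ an $|\mathcal{S}|\times|\mathcal{X}|$ stochastic matrix, $\mathcal{O}_{ix}=\mathbb{P}(X_t=x\mid S_t=i)$. The state sequence $(S_t)$ is a Markov chain with transition matrix $\mathcal{T}$, and given the state sequence the outputs $X_t$ are independent with $X_t\sim\mathcal{O}_{S_t\,\cdot}$. Irreducible means $\mathcal{T}$ is irreducible; then $\pi$ is its unique stationary distribution and $\mathbb{P}$ is the stationary measure on sequences $(S_t,X_t)_{t\ge0}$ with $S_0\sim\pi$; $\mathbb{P}_i(\cdot)=\mathbb{P}(\cdot\mid S_0=i)$. Each symbol $x\in\mathcal{X}$ is assumed to be emitted with positive probability from some state. Entropy rate and block estimates: with $(X_t)$ having law $\mathbb{P}$, Shannon entropy $H$ in base 2, and $X_a^b=X_a,\dots,X_b$, $h=\lim_{t\to\infty}H(X_1^t)/t$ and $h(t)=H(X_t\mid X_1^{t-1})$;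 one has $h(t)\searrow h$. $\delta_i(w)=\{j\in\mathcal{S}:\mathbb{P}_i(X_1^{|w|}=w,S_{|w|}=j)>0\}$ for words $w$ of length $|w|$, with $\delta_i(\lambda)=\{i\}$ for the empty word $\lambda$. $M$ is path-mergeable if for each pair of distinct states $i,j$ there exist a word $w$ and a state $k$ with $k\in\delta_i(w)\cap\delta_j(w)$. *)

(* Defs.v *)
From HB Require Import structures.
From mathcomp Require Import all_boot all_order all_algebra.
From mathcomp Require Import all_classical all_reals all_analysis.

Set Implicit Arguments.
Unset Strict Implicit.
Unset Printing Implicit Defensive.
Import Order.TTheory GRing.Theory Num.Theory.
Import numFieldNormedType.Exports.
Local Open Scope classical_set_scope.
Local Open Scope ring_scope.

Record hmm (R : realType) (S A : finType) := HMM {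
  hmm_T : S -> S -> R;
  hmm_O : S -> A -> R;
  hmm_T_ge0 : forall i j, 0 <= hmm_T i j;
  hmm_T_sum1 : forall i, \sum_(j : S) hmm_T i j = 1;
  hmm_O_ge0 : forall i x, 0 <= hmm_O i x;
  hmm_O_sum1 : forall i, \sum_(x : A) hmm_O i x = 1;
  hmm_O_supp : forall x, exists i, 0 < hmm_O i x
}.

Section HMMTheory.
Context {R : realType} {S A : finType}.
Implicit Types (M : hmm R S A) (mu : S -> R).

Fixpoint hmm_Tpow M (n : nat) (i j : S) : R :=
  if n is n'.+1 then \sum_(k : S) hmm_T M i k * hmm_Tpow M n' k j
  else (i == j)%:R.

Definition irreducible M : Prop :=
  forall i j : S, exists2 n : nat, (0 < n)%N & 0 < hmm_Tpow M n i j.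

Definition stationary M mu : Prop :=
  [/\ forall i, 0 <= mu i, \sum_(i : S) mu i = 1
    & forall j, \sum_(i : S) mu i * hmm_T M i j = mu j].

(* Joint law of (S_0, ..., S_n, X_0, ..., X_n) when S_0 ~ mu: the Markov chain
   law of the states, times the product of the emission probabilities, the
   outputs being independent given the states. *)
Definition hmm_law M mu (n : nat)
    (s : {ffun 'I_n.+1 -> S}) (x : {ffun 'I_n.+1 -> A}) : R :=
  mu (s ord0)
  * (\prod_(k < n) hmm_T M (s (inord k)) (s (inord k.+1)))
  * (\prod_(k < n.+1) hmm_O M (s k) (x k)).

(* P_i (X_1^n = w, S_n = j), where P_i has S_0 = i almost surely.  The letters
   of w are X_1, ..., X_n; X_0 is unconstrained and is summed out. *)
Definition word_state_prob M (i : S) (n : nat) (w : n.-tuple A) (j : S) : R :=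
  \sum_(s : {ffun 'I_n.+1 -> S} | s ord_max == j)
  \sum_(x : {ffun 'I_n.+1 -> A} | [forall k : 'I_n, x (lift ord0 k) == tnth w k])
    hmm_law M (fun i' => (i' == i)%:R) s x.

Definition delta M (i : S) (n : nat) (w : n.-tuple A) : {set S} :=
  [set j | 0 < word_state_prob M i w j]%SET.

Definition path_mergeable M : Prop :=
  forall i j : S, i != j ->
    exists (n : nat) (w : n.-tuple A) (k : S),
      k \in delta M i w :&: delta M j w.

End HMMTheory.

Section Processes.
Context {R : realType} {d : measure_display} {Omega : measurableType d}.
Context (P : probability Omega R).

(* The states and the alphabet carry the discrete sigma-algebra. *)
Definition hmm_process {S A : finType} (M : hmm R S A) (mu : S -> R)
    (St : nat -> Omega -> S) (X : nat -> Omega -> A) : Prop :=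
  [/\ forall t i, measurable (St t @^-1` [set i]),
      forall t x, measurable (X t @^-1` [set x])
    & forall (n : nat) (s : {ffun 'I_n.+1 -> S}) (x : {ffun 'I_n.+1 -> A}),
        P [set omega | forall k : 'I_n.+1, St k omega = s k /\ X k omega = x k]
        = (hmm_law M mu s x)%:E].

Definition log2 (x : R) : R := ln x / ln 2.

Definition pr (E : set Omega) : R := fine (P E).

(* In both entropies, outcomes of probability 0 contribute 0, since division by
   0 gives 0 and the logarithm is multiplied by 0. *)
Definition entropy {B : finType} (Y : Omega -> B) : R :=
  - \sum_(y : B) pr (Y @^-1` [set y]) * log2 (pr (Y @^-1` [set y])).

Definition cond_pr (E F : set Omega) : R := pr (E `&` F) / pr F.

Definition cond_entropy {B C : finType} (Y : Omega -> B) (Z : Omega -> C) : R :=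
  \sum_(z : C) pr (Z @^-1` [set z]) *
    - \sum_(y : B) cond_pr (Y @^-1` [set y]) (Z @^-1` [set z])
        * log2 (cond_pr (Y @^-1` [set y]) (Z @^-1` [set z])).

Context {A : finType}.
Implicit Type X : nat -> Omega -> A.

(* X_1^t; it starts at time 1, not 0. *)
Definition block X (t : nat) (omega : Omega) : t.-tuple A :=
  [tuple X k.+1 omega | k < t].

Definition entropy_rate X : R := limn (fun t : nat => entropy (block X t) / t%:R).

(* h(t); only meaningful for t >= 1. *)
Definition block_estimate X (t : nat) : R :=
  cond_entropy (X t) (block X t.-1).

End Processes.

(* Main.v *)
Require Import Defs.
From HB Require Import structures.
From mathcomp Require Import all_boot all_order all_algebra.
From mathcomp Require Import all_classical all_reals all_analysis.
From mathcomp Require Import ring lra.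

(* The decrement h(t) - h(t+1) is the conditional mutual information of X_0 and
   X_t given X_1^(t-1). For a word w = X_1^(t-1), let a and b be the forward
   vectors of w with and without the information X_0 = x, so that a <= b. Since
   ln r <= r - 1, the contribution of w is at most the excess m |b| - |a| summed
   over x, where m is the largest ratio a_k / b_k. The excess is a
   supermartingale: if r = m b - a >= 0, then reading a word z changes it to at
   most |r T_z|. It decreases strictly when z is such that every state reachable
   by z from anywhere is reachable by z from a state k with r_k > 0, because then
   m can be lowered. Path-mergeability and irreducibility provide such words,
   of one common length, for all k. Hence the excess, and with it the decrement,
   decays geometrically. *)

Set Implicit Arguments.
Unset Strict Implicit.
Unset Printing Implicit Defensive.
Import Order.TTheory GRing.Theory Num.Theory.
Import numFieldNormedType.Exports.
Local Open Scope classical_set_scope.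
Local Open Scope ring_scope.

(** * Sums over all words of a given length *)

Section WordSums.
Context {R : realType} {A : finType}.
Implicit Types (f g : seq A -> R).

(** Words are plain sequences here, so that concatenating and splitting them requires no transport
    between tuple types. *)
Fixpoint wsum (n : nat) f : R :=
  if n is m.+1 then \sum_(x : A) wsum m (fun w => f (x :: w)) else f [::].

Lemma ler_wsum n f g :
  (forall w, size w = n -> f w <= g w) -> wsum n f <= wsum n g.
Proof.
elim: n f g => [|n IH] f g fg /=; first exact: fg.
by apply: ler_sum => x _; apply: IH => w sw; apply: fg; rewrite /= sw.
Qed.

Lemma eq_wsum n f g :
  (forall w, size w = n -> f w = g w) -> wsum n f = wsum n g.
Proof.
by move=> fg; apply/le_anti/andP; split; apply: ler_wsum => w /fg ->.
Qed.

Lemma wsum_ge0 n f : (forall w, size w = n -> 0 <= f w) -> 0 <= wsum n f.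
Proof.
elim: n f => [|n IH] f f0 /=; first exact: f0.
by apply: sumr_ge0 => x _; apply: IH => w sw; apply: f0; rewrite /= sw.
Qed.

Lemma wsum_cat m n f :
  wsum (m + n) f = wsum m (fun u => wsum n (fun v => f (u ++ v))).
Proof.
elim: m f => [|m IH] f //=.
by apply: eq_bigr => x _; rewrite IH.
Qed.

Lemma wsum_rcons n f :
  wsum n.+1 f = wsum n (fun w => \sum_(y : A) f (rcons w y)).
Proof.
by rewrite -addn1 wsum_cat; apply: eq_wsum => w _ /=; apply: eq_bigr => y _;
  rewrite cats1.
Qed.

Lemma wsumB n f g : wsum n (fun w => f w - g w) = wsum n f - wsum n g.
Proof.
elim: n f g => [|n IH] f g //=.
by rewrite -sumrB; apply: eq_bigr => x _; rewrite IH.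
Qed.

Lemma wsumZ n c f : wsum n (fun w => c * f w) = c * wsum n f.
Proof.
elim: n f => [|n IH] f //=.
by rewrite mulr_sumr; apply: eq_bigr => x _; rewrite IH.
Qed.

Lemma wsum_sum (I : finType) n (F : I -> seq A -> R) :
  wsum n (fun w => \sum_(i : I) F i w) = \sum_(i : I) wsum n (F i).
Proof.
elim: n F => [|n IH] F //=.
by rewrite exchange_big; apply: eq_bigr => x _; rewrite IH.
Qed.

Lemma wsum_pick n f z : size z = n ->
  wsum n (fun w => if w == z then f w else 0) = f z.
Proof.
elim: n f z => [|n IH] f [|x z] //= [sz].
rewrite (bigD1 x) //= [X in _ + X]big1 ?addr0.
  rewrite -(IH (fun w => f (x :: w)) _ sz); apply: eq_wsum => w _.
  by rewrite eqseq_cons eqxx.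
move=> y yx; rewrite -[RHS](mul0r (wsum n (fun=> 0))) -wsumZ.
by apply: eq_wsum => w _; rewrite eqseq_cons (negPf yx) mul0r.
Qed.

Lemma sum_tuple_wsum n f : \sum_(z : n.-tuple A) f z = wsum n f.
Proof.
elim: n f => [|n IH] f /=.
  by rewrite (bigD1 [tuple]) //= big1 ?addr0 // => z; rewrite tuple0.
under [RHS]eq_bigr => x _ do rewrite -IH.
rewrite pair_bigA /=.
rewrite (reindex (fun p : A * n.-tuple A => cons_tuple p.1 p.2)) //=.
exists (fun z => (thead z, [tuple of behead z])) => [[x z] _|z _] /=.
  by rewrite theadE; congr (_, _); apply: val_inj.
by rewrite [RHS]tuple_eta; apply: val_inj.
Qed.

End WordSums.

(** * Forward vectors and word matrices *)

Section Forward.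
Context {R : realType} {S A : finType} (M : hmm R S A).
Implicit Types (v a b : S -> R) (w : seq A) (x y : A).

Definition fwd_step v x : S -> R :=
  fun l => \sum_(k : S) v k * (hmm_T M k l * hmm_O M l x).

(** The unnormalised filter: from initial weights [v], the joint weight of emitting [w] and ending
    in a given state. Each letter is emitted after a transition, so [w] starts at time 1. *)
Definition fwd v w : S -> R := foldl fwd_step v w.

Definition mass v : R := \sum_(k : S) v k.

(** The support of row [i] is the set $\delta_i(w)$. *)
Definition word_mx w (i j : S) : R := fwd (fun k => (k == i)%:R) w j.

Lemma fwd_rcons v w x : fwd v (rcons w x) = fwd_step (fwd v w) x.
Proof. by rewrite /fwd foldl_rcons. Qed.

Lemma fwd_cat v w w' : fwd v (w ++ w') = fwd (fwd v w) w'.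
Proof. by rewrite /fwd foldl_cat. Qed.

Lemma fwdE v w j : fwd v w j = \sum_(i : S) v i * word_mx w i j.
Proof.
elim/last_ind: w j => [|w x IH] j.
  rewrite (bigD1 j) //= /word_mx /= eqxx mulr1 big1 ?addr0 // => i ij.
  by rewrite eq_sym (negPf ij) mulr0.
rewrite /word_mx fwd_rcons /fwd_step.
under eq_bigr => k _ do rewrite IH mulr_suml.
rewrite exchange_big; apply: eq_bigr => i _ /=.
rewrite fwd_rcons /fwd_step mulr_sumr; apply: eq_bigr => k _.
by rewrite -mulrA.
Qed.

Lemma word_mx_cat w w' i j :
  word_mx (w ++ w') i j = \sum_(k : S) word_mx w i k * word_mx w' k j.
Proof. by rewrite /word_mx fwd_cat fwdE. Qed.

Lemma fwd_step_ge0 v x : (forall k, 0 <= v k) -> forall k, 0 <= fwd_step v x k.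
Proof.
move=> v0 k; apply: sumr_ge0 => l _.
by rewrite !mulr_ge0 ?hmm_T_ge0 ?hmm_O_ge0.
Qed.

Lemma fwd_ge0 v w : (forall k, 0 <= v k) -> forall k, 0 <= fwd v w k.
Proof.
move=> v0; elim/last_ind: w => [|w x IH] k //.
by rewrite fwd_rcons fwd_step_ge0.
Qed.

Lemma word_mx_ge0 w i j : 0 <= word_mx w i j.
Proof. by apply: fwd_ge0 => k; rewrite ler0n. Qed.

Lemma fwdB c a b w j :
  fwd (fun k => c * b k - a k) w j = c * fwd b w j - fwd a w j.
Proof.
rewrite !fwdE mulr_sumr -sumrB; apply: eq_bigr => i _.
by rewrite mulrBl mulrA.
Qed.

Lemma fwd_le a b w : (forall k, a k <= b k) -> forall k, fwd a w k <= fwd b w k.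
Proof.
move=> ab k; rewrite !fwdE; apply: ler_sum => i _.
by rewrite ler_wpM2r ?word_mx_ge0.
Qed.

Lemma mass_ge0 v : (forall k, 0 <= v k) -> 0 <= mass v.
Proof. by move=> v0; apply: sumr_ge0. Qed.

Lemma mass_ge v k : (forall k, 0 <= v k) -> v k <= mass v.
Proof.
by move=> v0; rewrite /mass (bigD1 k) //= lerDl sumr_ge0.
Qed.

Lemma mass_eq0 v : (forall k, 0 <= v k) -> mass v = 0 -> forall k, v k = 0.
Proof.
by move=> v0 m0 k; apply/le_anti; rewrite v0 -m0 mass_ge.
Qed.

Lemma sum_mass_fwd_step v : \sum_(x : A) mass (fwd_step v x) = mass v.
Proof.
rewrite /mass /fwd_step exchange_big /=.
under eq_bigr => l _ do rewrite exchange_big /=.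
rewrite exchange_big /=; apply: eq_bigr => k _.
under eq_bigr => l _ do
  rewrite -mulr_sumr -mulr_sumr hmm_O_sum1 mulr1.
by rewrite -mulr_sumr hmm_T_sum1 mulr1.
Qed.

Lemma wsum_mass_fwd n v : wsum n (fun w => mass (fwd v w)) = mass v.
Proof.
elim: n => [|n IH] //; rewrite wsum_rcons -[RHS]IH; apply: eq_wsum => w _.
by under eq_bigr => y _ do rewrite fwd_rcons; rewrite sum_mass_fwd_step.
Qed.

End Forward.

Lemma sumr_gt0_exists (R : realType) (I : finType) (F : I -> R) :
  (forall i, 0 <= F i) -> 0 < \sum_(i : I) F i -> exists i, 0 < F i.
Proof.
move=> F0 sF; apply: contrapT => nF; move: sF; rewrite big1 ?ltxx // => i _.
apply/le_anti; rewrite F0 andbT leNgt; apply/negP => Fi.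
by apply: nF; exists i.
Qed.

(** The cap [2^-1] gives a value when no [F i] is positive, and later makes the contraction factor
    [1 - e / #|S|] positive. *)
Lemma min_pos_lower_bound (R : realType) (I : finType) (F : I -> R) :
  exists2 e : R, 0 < e <= 2^-1 & forall i, 0 < F i -> e <= F i.
Proof.
exists (\big[Order.min/2^-1]_(i | 0 < F i) F i).
  by rewrite lt_bigmin ?invr_gt0 ?bigmin_le_id //=.
by move=> i Fi; apply: bigmin_le_cond.
Qed.

(** * Supports of word matrices: words with a row dominating all others *)

Section Words.
Context {R : realType} {S A : finType} (M : hmm R S A).
Local Notation U := (word_mx M).

Lemma word_mx_cat_gt0P w w' i j :
  reflect (exists2 k, 0 < U w i k & 0 < U w' k j) (0 < U (w ++ w') i j).
Proof.
rewrite word_mx_cat; apply: (iffP idP) => [/sumr_gt0_exists[k|k]|[k wk w'k]].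
- by rewrite mulr_ge0 ?word_mx_ge0.
- have := word_mx_ge0 M w i k; rewrite le_eqVlt => /predU1P[<-|wk].
    by rewrite mul0r ltxx.
  by rewrite pmulr_rgt0 //; exists k.
- rewrite (bigD1 k) //= ltr_pwDl ?mulr_gt0 // sumr_ge0 // => l _.
  by rewrite mulr_ge0 ?word_mx_ge0.
Qed.

Lemma word_mx1 x i j : U [:: x] i j = hmm_T M i j * hmm_O M j x.
Proof.
rewrite /word_mx /= /fwd_step (bigD1 i) //= eqxx mul1r big1 ?addr0 // => k.
by move=> /negPf ->; rewrite mul0r.
Qed.

Lemma exists_emission i : exists x, 0 < hmm_O M i x.
Proof.
by apply: sumr_gt0_exists => [x|]; rewrite ?hmm_O_ge0 // hmm_O_sum1.
Qed.

Lemma exists_letter i : exists x j, 0 < U [:: x] i j.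
Proof.
have [j Tij] : exists j, 0 < hmm_T M i j.
  by apply: sumr_gt0_exists => [x|]; rewrite ?hmm_T_ge0 // hmm_T_sum1.
have [x Ojx] := exists_emission j.
by exists x, j; rewrite word_mx1 mulr_gt0.
Qed.

Lemma irreducible_word : irreducible M -> forall i j, exists w, 0 < U w i j.
Proof.
move=> irrM i j; have [n _] := irrM i j.
elim: n i => [|n IH] i /=.
  have [->|_] := eqVneq i j; last by rewrite ltxx.
  by exists [::]; rewrite /word_mx /= eqxx.
case/sumr_gt0_exists => [k|k].
  rewrite mulr_ge0 ?hmm_T_ge0 //.
  elim: n k {IH} => [|n IH] k /=; first by rewrite ler0n.
  by apply: sumr_ge0 => l _; rewrite mulr_ge0 ?hmm_T_ge0.
have := hmm_T_ge0 M i k; rewrite le_eqVlt => /predU1P[<-|Tik].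
  by rewrite mul0r ltxx.
rewrite pmulr_rgt0 // => /IH[w wkj]; have [x Okx] := exists_emission k.
exists ([:: x] ++ w); apply/word_mx_cat_gt0P; exists k => //.
by rewrite word_mx1 mulr_gt0.
Qed.

Hypothesis irr : forall i j, exists w, 0 < U w i j.
Hypothesis mrg : forall i j, exists w k, 0 < U w i k /\ 0 < U w j k.

(** Call a nonzero row bad if it vanishes at [k]. If a bad row is positive at [j], appending a word
    that merges [k] and [j] at [k'] repairs this row, and the rows positive at [k] become positive
    at [k']. So the number of bad rows drops until none is left. *)
Lemma exists_flag_word : S -> exists w k, (exists i, 0 < U w i k) /\
  forall i j, 0 < U w i j -> 0 < U w i k.
Proof.
move=> s0.
pose bad w k := [set i | [exists j, 0 < U w i j] && ~~ (0 < U w i k)]%SET.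
suff main n w k : (exists i, 0 < U w i k) -> (#|bad w k| <= n)%N ->
    exists w k, (exists i, 0 < U w i k) /\
      forall i j, 0 < U w i j -> 0 < U w i k.
  apply: (main #|bad [::] s0| [::] s0) => //.
  by exists s0; rewrite /word_mx /= eqxx.
elim: n w k => [|n IH] w k wk; have [bad0|[i ibad]] := set_0Vmem (bad w k).
- move=> _; exists w, k; split => // i j wij; apply: contraT => wik.
  by have : i \in bad w k; [rewrite inE wik andbT; apply/existsP; exists j
    |rewrite bad0 inE].
- by rewrite leqn0 cards_eq0 => /eqP b0; rewrite b0 inE in ibad.
- move=> _; exists w, k; split => // i j wij; apply: contraT => wik.
  by have : i \in bad w k; [rewrite inE wik andbT; apply/existsP; exists j
    |rewrite bad0 inE].
move=> cn; have := ibad; rewrite inE => /andP[/existsP[j wij] wik].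
have [v [k' [vk vj]]] := mrg k j.
apply: (IH (w ++ v) k').
  by have [a wa] := wk; exists a; apply/word_mx_cat_gt0P; exists k.
rewrite -ltnS; apply: leq_trans cn; apply: proper_card.
apply/properP; split; last first.
  exists i => //; rewrite inE negb_and; apply/orP; right; rewrite negbK.
  by apply/word_mx_cat_gt0P; exists j.
apply/fintype.subsetP => a; rewrite !inE => /andP[/existsP[l /word_mx_cat_gt0P[m wam _]] na].
apply/andP; split; first by apply/existsP; exists m.
by apply: contra na => wak; apply/word_mx_cat_gt0P; exists k.
Qed.

(* For a flag word y looping at k, passing from y to v y y for a suitable v
   enlarges the row of k, unless y y already has a full row at k. *)
Lemma exists_row_full_word : S -> exists w k, (exists j, 0 < U w k j) /\
  forall i j, 0 < U w i j -> 0 < U w k j.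
Proof.
move=> s0; have [w0 [k [[i0 w0i] flag0]]] := exists_flag_word s0.
pose gap y := [set j | [exists i, 0 < U y i j] && ~~ (0 < U y k j)]%SET.
suff main n y : 0 < U y k k -> (forall i j, 0 < U y i j -> 0 < U y i k) ->
    (#|gap y| <= n)%N -> exists w k, (exists j, 0 < U w k j) /\
      forall i j, 0 < U w i j -> 0 < U w k j.
  have [v vk] := irr k i0.
  apply: (main #|gap (v ++ w0)| (v ++ w0)) => //.
    by apply/word_mx_cat_gt0P; exists i0.
  move=> i j /word_mx_cat_gt0P[m vm wm]; apply/word_mx_cat_gt0P; exists m => //.
  exact: flag0 wm.
elim: n y => [|n IH] y yk flag cn.
  exists y, k; split=> [|i j yij]; first by exists k.
  move: cn; rewrite leqn0 cards_eq0 => /eqP/setP/(_ j).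
  rewrite !inE; have -> : [exists i, 0 < U y i j] by apply/existsP; exists i.
  by move/negbFE.
have [[d [l [yyl nyl]]]|none] :=
  pselect (exists d l, 0 < U (y ++ y) d l /\ ~~ (0 < U y k l)); last first.
  exists (y ++ y), k; split=> [|i j yyij].
    by exists k; apply/word_mx_cat_gt0P; exists k.
  apply/word_mx_cat_gt0P; exists k => //; apply: contraT => nykj.
  by case: none; exists i, j.
have yyflag i j : 0 < U (y ++ y) i j -> 0 < U (y ++ y) i k.
  move=> /word_mx_cat_gt0P[m yim _]; apply/word_mx_cat_gt0P; exists k => //.
  exact: flag yim.
have yd : 0 < U y d k by case/word_mx_cat_gt0P: yyl => m /flag.
(* Along [v] one goes from [k] to [d], and [y] takes [d] back to [k]. Hence row [k] of
   [v ++ (y ++ y)] contains row [k] of [y], and also [l], while the reachable columns stay among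
   those of [y]. *)
have [v vd] := irr k d.
apply: (IH (v ++ (y ++ y))).
- by apply/word_mx_cat_gt0P; exists d => //; apply: yyflag yyl.
- move=> i j /word_mx_cat_gt0P[m vm ym]; apply/word_mx_cat_gt0P; exists m => //.
  exact: yyflag ym.
rewrite -ltnS; apply: leq_trans cn; apply: proper_card.
apply/properP; split; last first.
  exists l; rewrite inE.
    rewrite nyl andbT; apply/existsP.
    by case/word_mx_cat_gt0P: yyl => m _ yml; exists m.
  rewrite negb_and; apply/orP; right; rewrite negbK.
  by apply/word_mx_cat_gt0P; exists d.
apply/fintype.subsetP => j; rewrite !inE => /andP[/existsP[i]].
move=> /word_mx_cat_gt0P[a _ /word_mx_cat_gt0P[b _ ybj]] nj.
apply/andP; split; first by apply/existsP; exists b.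
apply: contra nj => ykj; apply/word_mx_cat_gt0P; exists d => //.
by apply/word_mx_cat_gt0P; exists k.
Qed.

(** Dominance of row [k] survives any appended letter; the letter is chosen so that the row stays
    nonzero. *)
Lemma row_full_pad n w k : (exists j, 0 < U w k j) ->
  (forall i j, 0 < U w i j -> 0 < U w k j) ->
  exists w', [/\ size w' = (size w + n)%N, exists j, 0 < U w' k j &
    forall i j, 0 < U w' i j -> 0 < U w' k j].
Proof.
elim: n w => [|n IH] w [j wj] full.
  by exists w; split; rewrite ?addn0 //; exists j.
have [x [l xl]] := exists_letter j.
have [||w' [sw' ne full']] := IH (w ++ [:: x]).
- by exists l; apply/word_mx_cat_gt0P; exists j.
- move=> a b /word_mx_cat_gt0P[m wm xm]; apply/word_mx_cat_gt0P; exists m => //.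
  exact: full wm.
by exists w'; split; rewrite // sw' size_cat addn1 addSnnS.
Qed.

(** Prefixing a word that leads from [i] to [k] transfers the dominating row from [k] to [i];
    padding then equalizes the lengths. *)
Lemma exists_block_words : S -> exists (L : nat) (e : R),
  [/\ (0 < L)%N, 0 < e <= 2^-1 &
    forall k, exists z, [/\ size z = L, exists j, e <= U z k j &
      forall i j, 0 < U z i j -> e <= U z k j]].
Proof.
move=> s0; have [w [k [ne full]]] := exists_row_full_word s0.
have /choice[f fP] i : exists v, 0 < U v i k by apply: irr.
(* The sum bounds every single length, and the successor makes [L] positive. *)
pose L := (\sum_(i : S) (size (f i ++ w))).+1.
have /choice[z zP] i : exists z, [/\ size z = L, exists j, 0 < U z i j &
    forall a j, 0 < U z a j -> 0 < U z i j].
  have [j wj] := ne.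
  have [||z [sz zne zfull]] := @row_full_pad (L - size (f i ++ w))%N (f i ++ w) i.
  - by exists j; apply/word_mx_cat_gt0P; exists k.
  - move=> a b /word_mx_cat_gt0P[m _ wm]; apply/word_mx_cat_gt0P; exists k => //.
    exact: full wm.
  exists z; split => //; rewrite sz subnKC // /L (bigD1 i) //=.
  by rewrite -addnS leq_addr.
(* Only row [i] of the word chosen for [i] matters, so finitely many entries have to be bounded
   below. *)
have [e e0 eP] := @min_pos_lower_bound R (S * S)%type
  (fun p => U (z p.1) p.1 p.2).
exists L, e; split=> // i; exists (z i); have [sz [j zj] zfull] := zP i.
split=> //; first by exists j; apply: (eP (i, j)).
by move=> a b /zfull zib; apply: (eP (i, b)).
Qed.

End Words.

(** * Geometric decay of the excess *)

Section Contraction.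
Context {R : realType} {S A : finType} (M : hmm R S A).
Implicit Types (a b v : S -> R) (w : seq A).
Local Notation U := (word_mx M).

(** Division by 0 makes the ratio 0 where [b k = 0]; this is consistent with [0 <= a <= b], which
    forces [a k = 0] there. *)
Definition max_ratio a b : R := \big[Order.max/0]_(k : S) (a k / b k).

(* For 0 <= a <= b, the least mass of a nonnegative vector c *: b - a. *)
Definition excess a b : R := max_ratio a b * mass b - mass a.

Lemma le_max_ratio a b : (forall k, 0 <= a k <= b k) ->
  forall k, a k <= max_ratio a b * b k.
Proof.
move=> ab k; have /andP[ak abk] := ab k.
have := le_trans ak abk; rewrite [0 <= _]le_eqVlt => /predU1P[bk|bk].
  by move: abk; rewrite -bk mulr0.
by rewrite -ler_pdivrMr // /max_ratio; apply: (le_bigmax _ (fun k => a k / b k)).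
Qed.

(** Minimality of the maximal ratio: every dominating constant [c] gives an upper bound. All later
    bounds arise by exhibiting such a constant. *)
Lemma excess_le a b c : (forall k, 0 <= a k) -> (forall k, 0 <= b k) ->
  (forall k, a k <= c * b k) -> excess a b <= c * mass b - mass a.
Proof.
move=> a0 b0 ac; rewrite /excess lerD2r.
have := mass_ge0 b0; rewrite [0 <= _]le_eqVlt => /predU1P[<-|mb]; first by rewrite !mulr0.
have c0 : 0 <= c.
  have [k bk] := sumr_gt0_exists b0 mb.
  by rewrite -(pmulr_lge0 _ bk) (le_trans (a0 k)).
rewrite ler_wpM2r ?mass_ge0 //; apply: bigmax_le => // k _.
have := b0 k; rewrite [0 <= _]le_eqVlt => /predU1P[<-|bk]; first by rewrite invr0 mulr0.
by rewrite ler_pdivrMr.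
Qed.

Lemma massB c a b : mass (fun k => c * b k - a k) = c * mass b - mass a.
Proof. by rewrite /mass sumrB mulr_sumr. Qed.

Lemma fwd_range a b w : (forall k, 0 <= a k <= b k) ->
  forall k, 0 <= fwd M a w k <= fwd M b w k.
Proof.
move=> ab k; apply/andP; split; first by apply: fwd_ge0 => l; case/andP: (ab l).
by apply: fwd_le => l; case/andP: (ab l).
Qed.

(** The old ratio still dominates after reading [w], because the forward map is linear and preserves
    nonnegativity. *)
Lemma excess_fwd_le a b w : (forall k, 0 <= a k <= b k) ->
  excess (fwd M a w) (fwd M b w) <=
  mass (fwd M (fun k => max_ratio a b * b k - a k) w).
Proof.
move=> ab; have abw := fwd_range w ab.
have -> : mass (fwd M (fun k => max_ratio a b * b k - a k) w) =
    max_ratio a b * mass (fwd M b w) - mass (fwd M a w).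
  by rewrite -massB; apply: eq_bigr => k _; rewrite fwdB.
apply: excess_le => k; [by case/andP: (abw k)| |].
  by case/andP: (abw k); apply: le_trans.
rewrite -subr_ge0 -fwdB; apply: fwd_ge0 => l.
by rewrite subr_ge0 le_max_ratio.
Qed.

Lemma excess_wsum_le n a b : (forall k, 0 <= a k <= b k) ->
  wsum n (fun w => excess (fwd M a w) (fwd M b w)) <= excess a b.
Proof.
move=> ab; rewrite -[leRHS]massB -(wsum_mass_fwd M n).
by apply: ler_wsum => w _; apply: excess_fwd_le.
Qed.

(** Each state that [z] can reach receives at least [e * r k] from state [k], where [r] is the gap
    vector. So after [z] the dominating constant can be lowered by [e * r k] divided by the mass of
    [fwd M b z]. *)
Lemma excess_row_full a b z k e : (forall l, 0 <= a l <= b l) -> 0 < e ->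
  (exists j, e <= U z k j) -> (forall i j, 0 < U z i j -> e <= U z k j) ->
  excess (fwd M a z) (fwd M b z) <=
  mass (fwd M (fun l => max_ratio a b * b l - a l) z)
    - e * (max_ratio a b * b k - a k).
Proof.
move=> ab e0 [j0 zj0] full; pose r l := max_ratio a b * b l - a l.
rewrite -/(r k) -/r; have abz := fwd_range z ab.
have r0 l : 0 <= r l by rewrite subr_ge0 le_max_ratio.
have az0 l : 0 <= fwd M a z l by case/andP: (abz l).
have bz0 l : 0 <= fwd M b z l by case/andP: (abz l); apply: le_trans.
have rzE l : fwd M r z l = max_ratio a b * fwd M b z l - fwd M a z l.
  by rewrite fwdB.
have mrzE : mass (fwd M r z) = max_ratio a b * mass (fwd M b z) - mass (fwd M a z).
  by rewrite -massB; apply: eq_bigr => l _.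
have rz_ge l : e <= U z k l -> e * r k <= fwd M r z l.
  move=> el; rewrite fwdE (bigD1 k) //= mulrC.
  rewrite (le_trans (ler_wpM2l (r0 k) el)) // lerDl sumr_ge0 // => i _.
  by rewrite mulr_ge0 ?word_mx_ge0.
(* If [fwd M b z] vanishes, nothing can be divided by its mass. The positive entry of row [k] at
   [j0] then forces [e * r k = 0]. *)
have := mass_ge0 bz0; rewrite [0 <= _]le_eqVlt => /predU1P[mb|mb].
  have bz l : fwd M b z l = 0 by apply: mass_eq0.
  have rk : e * r k = 0.
    apply/le_anti; rewrite mulr_ge0 ?(ltW e0) // andbT.
    rewrite (le_trans (rz_ge _ zj0)) // rzE bz mulr0 sub0r oppr_le0 //.
  by rewrite rk subr0; apply: excess_fwd_le.
pose t := e * r k / mass (fwd M b z).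
have -> : mass (fwd M r z) - e * r k =
    (max_ratio a b - t) * mass (fwd M b z) - mass (fwd M a z).
  by rewrite mulrBl /t divfK ?gt_eqF // mrzE addrAC.
apply: excess_le => // l.
have := bz0 l; rewrite [0 <= _]le_eqVlt => /predU1P[bl|bl].
  by rewrite -bl mulr0; case/andP: (abz l) => _; rewrite -bl.
rewrite mulrBl lerBrDr addrC -lerBrDr -rzE.
apply: (@le_trans _ _ (e * r k)).
  rewrite /t mulrAC -mulrA ler_piMr ?mulr_ge0 ?(ltW e0) //.
  by rewrite ler_pdivrMr // mul1r mass_ge.
apply: rz_ge; move: bl; rewrite fwdE => /sumr_gt0_exists[i|i bi].
  rewrite mulr_ge0 ?word_mx_ge0 //.
  by case/andP: (ab i); apply: le_trans.
apply: (full i); rewrite lt_def word_mx_ge0 andbT.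
by apply: contraTneq bi => ->; rewrite mulr0 ltxx.
Qed.

(** The word chosen for [k] saves [e * r k]. Adding these bounds over all [k] saves [e] times the
    mass of [r], which is [e] times the excess. *)
Lemma excess_block L e a b : (0 < e) ->
  (forall k, exists z, [/\ size z = L, exists j, e <= U z k j &
      forall i j, 0 < U z i j -> e <= U z k j]) ->
  (forall k, 0 <= a k <= b k) ->
  #|S|%:R * wsum L (fun w => excess (fwd M a w) (fwd M b w)) <=
    (#|S|%:R - e) * excess a b.
Proof.
move=> e0 blk ab.
pose r := fun l => max_ratio a b * b l - a l.
have mr : mass r = excess a b by rewrite massB.
have er : e * mass r = \sum_k e * r k by rewrite mulr_sumr.
rewrite mulrBl -mr er mulr_natl mulr_natl -!sumr_const -sumrB; apply: ler_sum => k _.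
have [z [sz ne full]] := blk k.
(* The whole saving is charged to the single word [z]; the other words get the bound without
   saving. *)
rewrite -(wsum_mass_fwd M L r) -(wsum_pick (fun=> e * r k) sz) -wsumB.
apply: ler_wsum => w _; case: eqP => [->|_].
  exact: excess_row_full.
by rewrite subr0; apply: excess_fwd_le.
Qed.

Lemma excess_decay : S -> 
  (forall i j, exists w, 0 < U w i j) ->
  (forall i j, exists w k, 0 < U w i k /\ 0 < U w j k) ->
  exists c alpha : R, [/\ 0 < c, 0 < alpha < 1 &
    forall n a b, (forall k, 0 <= a k <= b k) ->
      wsum n (fun w => excess (fwd M a w) (fwd M b w)) <=
        c * alpha ^+ n * mass b].
Proof.
move=> s0 irr mrg.
have [L [e [L0 /andP[e0 e2] blk]]] := exists_block_words irr mrg s0.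
have N0 : (0 < #|S|)%N by apply/card_gt0P; exists s0.
pose rho : R := 1 - e / #|S|%:R.
have rho0 : 0 < rho.
  rewrite subr_gt0 ltr_pdivrMr ?ltr0n // mul1r.
  have : (1 : R) <= #|S|%:R by rewrite ler1n.
  lra.
have rho1 : rho < 1 by rewrite gtrBl divr_gt0 // ltr0n.
(* Each of the [q] blocks of length [L] contributes a factor [rho]; the [r] remaining letters do not
   increase the excess. *)
have iter q r a b : (forall k, 0 <= a k <= b k) ->
    wsum (q * L + r) (fun w => excess (fwd M a w) (fwd M b w)) <=
      rho ^+ q * excess a b.
  elim: q a b => [|q IH] a b ab; first by rewrite mul1r excess_wsum_le.
  rewrite mulSn -addnA wsum_cat.
  apply: (@le_trans _ _ (wsum L (fun u =>
      rho ^+ q * excess (fwd M a u) (fwd M b u)))).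
    apply: ler_wsum => u _; have := IH _ _ (fwd_range u ab).
    congr (_ <= _); apply: eq_wsum => w _.
    by rewrite !fwd_cat.
  rewrite wsumZ exprSr -mulrA ler_wpM2l ?exprn_ge0 ?(ltW rho0) //.
  rewrite -(@ler_pM2l _ #|S|%:R) ?ltr0n //.
  rewrite mulrA (_ : _ * rho = #|S|%:R - e); first exact: excess_block.
  by rewrite /rho; field; rewrite pnatr_eq0 -lt0n.
pose alpha := rho `^ L%:R^-1.
have alphaL : alpha ^+ L = rho.
  rewrite -powR_mulrn ?powR_ge0 // -powRrM mulVf ?pnatr_eq0 -?lt0n //.
  by rewrite powRr1 // ltW.
have alpha0 : 0 < alpha by rewrite powR_gt0.
have alpha1 : alpha < 1.
  by rewrite -(expr_lt1 L0) ?alphaL // ltW.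
(* The constant makes up for the incomplete block: [n %/ L * L] exceeds [n - L]. *)
exists (alpha ^- L), alpha; split; rewrite ?alpha0 // ?invr_gt0 ?exprn_gt0 //.
move=> n a b ab; rewrite {1}(divn_eq n L).
apply: le_trans (iter _ _ _ _ ab) _.
have b0 k : 0 <= b k by case/andP: (ab k); apply: le_trans.
apply: ler_pM; rewrite ?exprn_ge0 ?(ltW rho0) //.
- rewrite /excess -massB; apply: mass_ge0 => k.
  by rewrite subr_ge0 le_max_ratio.
- rewrite mulrC ler_pdivlMr ?exprn_gt0 // -alphaL -exprM -exprD.
  apply: ler_wiXn2l; rewrite ?(ltW alpha0) ?(ltW alpha1) //.
  rewrite {1}(divn_eq n L) mulnC leq_add2l ltnW // ltn_pmod //.
(* As [a <= b], the constant 1 dominates, so the excess is at most [mass b]. *)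
have := @excess_le a b 1 _ b0 _; rewrite mul1r => H.
apply: le_trans (H _ _) _ => [k|k|]; rewrite ?mul1r; try by case/andP: (ab k).
by rewrite gerBl mass_ge0 // => k; case/andP: (ab k).
Qed.

End Contraction.

(** * Entropies of the word distribution and their decrements *)

Section EntropyIncrements.
Context {R : realType} {S A : finType} (M : hmm R S A) (pi : S -> R).
Hypothesis statpi : stationary M pi.
Implicit Types (w z : seq A) (x y : A).

Definition word_pr (w : seq A) : R := mass (fwd M pi w).
Local Notation p := word_pr.

Lemma stationary_ge0 k : 0 <= pi k. Proof. by case: statpi. Qed.

Lemma word_pr_nil : p [::] = 1. Proof. by case: statpi. Qed.

Lemma word_pr_ge0 w : 0 <= p w.
Proof. by apply: mass_ge0; apply: fwd_ge0 => k; apply: stationary_ge0. Qed.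

Lemma sum_word_pr_rcons w : \sum_(y : A) p (rcons w y) = p w.
Proof.
rewrite /word_pr -[RHS](sum_mass_fwd_step M).
by apply: eq_bigr => y _; rewrite fwd_rcons.
Qed.

Lemma sum_word_pr_cons_rcons x w : \sum_(y : A) p (x :: rcons w y) = p (x :: w).
Proof. exact: (sum_word_pr_rcons (x :: w)). Qed.

Lemma sum_fwd_step_stationary k : \sum_(x : A) fwd_step M pi x k = pi k.
Proof.
have [_ _ pT] := statpi; rewrite -[RHS]pT /fwd_step exchange_big /=.
by apply: eq_bigr => l _; rewrite -mulr_sumr -mulr_sumr hmm_O_sum1 mulr1.
Qed.

(** This is shift invariance: summing out the first letter from [pi] returns [pi]. *)
Lemma sum_word_pr_cons w : \sum_(x : A) p (x :: w) = p w.
Proof.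
rewrite /word_pr /mass exchange_big /=; apply: eq_bigr => k _.
rewrite [RHS]fwdE; under eq_bigr => x _ do rewrite fwdE.
rewrite exchange_big /=; apply: eq_bigr => i _.
by rewrite -mulr_suml sum_fwd_step_stationary.
Qed.

Lemma fwd_step_le_stationary x k : 0 <= fwd_step M pi x k <= pi k.
Proof.
have s0 y : 0 <= fwd_step M pi y k by apply: fwd_step_ge0 => l; apply: stationary_ge0.
by rewrite s0 -[leRHS]sum_fwd_step_stationary (bigD1 x) //= lerDl sumr_ge0.
Qed.

Definition word_entropy n : R := - wsum n (fun z => p z * log2 (p z)).

(** This is $H(X_{n+1} \mid X_1^n)$, hence $h(n+1)$ and not $h(n)$. *)
Definition cond_word_entropy n : R :=
  - wsum n (fun z => \sum_(y : A) p (rcons z y) * log2 (p (rcons z y) / p z)).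

Lemma word_pr_rcons_le w y : p (rcons w y) <= p w.
Proof.
rewrite -[leRHS]sum_word_pr_rcons (bigD1 y) //= lerDl sumr_ge0 // => z _.
exact: word_pr_ge0.
Qed.

Lemma word_pr_cons_le w x : p (x :: w) <= p w.
Proof.
rewrite -[leRHS]sum_word_pr_cons (bigD1 x) //= lerDl sumr_ge0 // => z _.
exact: word_pr_ge0.
Qed.

Lemma log2_div (a b : R) : 0 < a -> 0 < b -> log2 (a / b) = log2 a - log2 b.
Proof. by move=> a0 b0; rewrite /log2 ln_div ?posrE // mulrBl. Qed.

(** The chain rule for entropy. *)
Lemma word_entropyS n :
  word_entropy n.+1 = word_entropy n + cond_word_entropy n.
Proof.
rewrite /word_entropy /cond_word_entropy -opprD; congr (- _).
rewrite wsum_rcons; apply/eqP; rewrite [X in _ == X]addrC -subr_eq -wsumB; apply/eqP.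
apply: eq_wsum => z _.
have -> : p z * log2 (p z) = \sum_(y : A) p (rcons z y) * log2 (p z).
  by rewrite -mulr_suml sum_word_pr_rcons.
rewrite -sumrB; apply: eq_bigr => y _.
have := word_pr_ge0 (rcons z y); rewrite le_eqVlt => /predU1P[<-|pzy].
  by rewrite !mul0r subr0.
by rewrite log2_div ?(lt_le_trans pzy (word_pr_rcons_le _ _)) // mulrBr.
Qed.

Lemma word_entropyE n : word_entropy n = \sum_(0 <= k < n) cond_word_entropy k.
Proof.
elim: n => [|n IH]; last by rewrite word_entropyS big_nat_recr //= IH.
by rewrite big_geq // /word_entropy /= word_pr_nil /log2 ln1 mul0r mulr0 oppr0.
Qed.

(** The contribution of the middle word [z] to the conditional mutual information of the letter [x]
    before it and the letter [y] after it. *)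
Definition info_increment z : R :=
  \sum_(x : A) \sum_(y : A) p (x :: rcons z y) *
    (log2 (p (x :: rcons z y) / p (x :: z)) - log2 (p (rcons z y) / p z)).

Lemma cond_word_entropyB n :
  cond_word_entropy n - cond_word_entropy n.+1 = wsum n info_increment.
Proof.
rewrite /cond_word_entropy opprK addrC [wsum n.+1 _]/= -wsum_sum -wsumB.
apply: eq_wsum => z _; rewrite /info_increment.
under [X in _ = X]eq_bigr => x _ do
  (under eq_bigr => y _ do rewrite mulrBr; rewrite sumrB).
rewrite sumrB; congr (_ - _); rewrite exchange_big /=; apply: eq_bigr => y _.
by rewrite -mulr_suml sum_word_pr_cons.
Qed.

Lemma ln_le_sub1 (r : R) : 0 < r -> ln r <= r - 1.
Proof.
move=> r0; have := @le_ln1Dx R (r - 1); rewrite [1 + _]addrC subrK; apply.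
by rewrite ltrBrDr addNr.
Qed.

Lemma ln2_gt0 : 0 < ln 2 :> R. Proof. by rewrite ln_gt0 // ltr1n. Qed.

(** Apply [ln r <= r - 1] to [r = s * u / (v * t)]. In the application [t], [s], [u], [v] are the
    probabilities of [xzy], [xz], [zy], [z]. *)
Lemma mul_ln_ratio_ge (t s u v : R) : 0 <= t -> 0 <= s -> 0 <= u ->
  t <= s -> t <= u -> u <= v -> t - s * u / v <= t * (ln (t / s) - ln (u / v)).
Proof.
move=> t0 s0 u0 ts tu uv.
move: t0; rewrite le_eqVlt => /predU1P[<-|t0].
  by rewrite mul0r sub0r oppr_le0 divr_ge0 ?mulr_ge0 // (le_trans u0).
have s1 := lt_le_trans t0 ts; have u1 := lt_le_trans t0 tu.
have v1 := lt_le_trans u1 uv.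
have := @ln_le_sub1 (s * u / (v * t)).
rewrite !ln_div ?lnM ?posrE ?divr_gt0 ?mulr_gt0 // => /(_ isT).
move=> /(ler_wpM2l (ltW t0)).
have -> : t * (s * u / (v * t) - 1) = s * u / v - t.
  by field; rewrite !gt_eqF.
lra.
Qed.

(** Here [ln r <= r - 1] is applied to the inverse ratio [t * v / (s * u)], which is at most
    [m * v / s]. *)
Lemma mul_ln_ratio_le (t s u v m : R) : 0 <= t -> 0 < s ->
  t <= s -> t <= u -> u <= v -> t <= m * u ->
  t * (ln (t / s) - ln (u / v)) <= t * (m * v / s - 1).
Proof.
move=> t0 s1 ts tu uv tmu.
move: t0; rewrite le_eqVlt => /predU1P[<-|t0]; first by rewrite !mul0r.
have u1 := lt_le_trans t0 tu.
have v1 := lt_le_trans u1 uv.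
rewrite ler_pM2l //.
have := @ln_le_sub1 (t * v / (s * u)).
rewrite !ln_div ?lnM ?posrE ?divr_gt0 ?mulr_gt0 // => /(_ isT).
have : t * v / (s * u) <= m * v / s.
  rewrite ler_pdivrMr ?mulr_gt0 //.
  have -> : m * v / s * (s * u) = (m * u) * v by field; rewrite gt_eqF.
  by rewrite ler_wpM2r // ltW.
lra.
Qed.

Lemma log2B (a b : R) : log2 a - log2 b = (ln a - ln b) / ln 2.
Proof. by rewrite /log2 mulrBl. Qed.

Lemma info_increment_ge0 z : 0 <= info_increment z.
Proof.
rewrite /info_increment.
under eq_bigr => x _ do
  (under eq_bigr => y _ do rewrite log2B mulrA; rewrite -mulr_suml).
rewrite -mulr_suml divr_ge0 ?(ltW ln2_gt0) //.
(* Summed over [x] and [y], these lower bounds give [p z - p z * p z / p z], which is 0. *)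
apply: (@le_trans _ _ (\sum_(x : A) \sum_(y : A)
    (p (x :: rcons z y) - p (x :: z) * p (rcons z y) / p z))).
  under eq_bigr => x _ do rewrite sumrB sum_word_pr_cons_rcons
    -mulr_suml -mulr_sumr sum_word_pr_rcons.
  rewrite sumrB -mulr_suml -mulr_suml sum_word_pr_cons subr_ge0.
  have := word_pr_ge0 z; rewrite le_eqVlt => /predU1P[<-|pz].
    by rewrite mul0r mul0r.
  by rewrite mulfK ?gt_eqF.
apply: ler_sum => x _; apply: ler_sum => y _.
apply: mul_ln_ratio_ge; rewrite ?word_pr_ge0 ?word_pr_cons_le
  ?word_pr_rcons_le //.
by rewrite -rcons_cons word_pr_rcons_le.
Qed.

(** The maximal ratio [m] of the forward vectors also bounds the probability of [xzy] by [m] times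
    that of [zy]. Summing the logarithmic bound over [y] leaves [m * p z - p (x :: z)], the
    excess. *)
Lemma info_increment_le z : info_increment z <=
  (\sum_(x : A) excess (fwd M (fwd_step M pi x) z) (fwd M pi z)) / ln 2.
Proof.
rewrite /info_increment mulr_suml; apply: ler_sum => x _.
under eq_bigr => y _ do rewrite log2B mulrA.
rewrite -mulr_suml ler_pM2r ?invr_gt0 ?ln2_gt0 //.
set a := fwd M (fwd_step M pi x) z; set b := fwd M pi z.
have ab : forall k, 0 <= a k <= b k.
  by apply: fwd_range => k; apply: fwd_step_le_stationary.
have mab := le_max_ratio ab.
have := word_pr_ge0 (x :: z); rewrite [0 <= _]le_eqVlt => /predU1P[p0|p0].
  rewrite big1 => [|y _]; last first.
    suff -> : p (x :: rcons z y) = 0 by rewrite mul0r.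
    by apply/le_anti; rewrite word_pr_ge0 p0 -rcons_cons word_pr_rcons_le.
  rewrite /excess -massB; apply: mass_ge0 => k.
  by rewrite subr_ge0.
apply: (@le_trans _ _ (\sum_(y : A) p (x :: rcons z y) *
    (max_ratio a b * p z / p (x :: z) - 1))).
  apply: ler_sum => y _; apply: mul_ln_ratio_le; rewrite ?word_pr_ge0
    ?word_pr_cons_le ?word_pr_rcons_le //.
    by rewrite -rcons_cons word_pr_rcons_le.
  rewrite -subr_ge0 /word_pr -rcons_cons !fwd_rcons -massB.
  apply: mass_ge0 => k.
  have -> : max_ratio a b * fwd_step M (fwd M pi z) y k -
      fwd_step M (fwd M pi (x :: z)) y k =
      fwd_step M (fun k => max_ratio a b * b k - a k) y k.
    rewrite /fwd_step mulr_sumr -sumrB; apply: eq_bigr => l _.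
    by rewrite mulrBl mulrA.
  by apply: fwd_step_ge0 => l; rewrite subr_ge0.
by rewrite -mulr_suml sum_word_pr_cons_rcons mulrBr mulr1 mulrC divfK ?gt_eqF.
Qed.

Lemma cond_word_entropy_decrements : irreducible M ->
  (forall i j, exists w k, 0 < word_mx M w i k /\ 0 < word_mx M w j k) ->
  exists c alpha : R, [/\ 0 < c, 0 < alpha < 1 & forall n,
    0 <= cond_word_entropy n - cond_word_entropy n.+1 <= c * alpha ^+ n].
Proof.
move=> irrM mrg.
have [s0] : exists s : S, 0 < pi s.
  by apply: sumr_gt0_exists stationary_ge0 _; case: statpi => _ ->.
move=> _; have [c [alpha [c0 alpha01 dec]]] :=
  excess_decay s0 (irreducible_word irrM) mrg.
(* One excess for each letter [x], of total mass at most that of [pi], which is 1; [ln 2] comes from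
   the base of the logarithm. The successor gives positivity at once. *)
exists (c * (#|A|.+1)%:R / ln 2), alpha; split=> //.
  by rewrite divr_gt0 ?ln2_gt0 // mulr_gt0 // ltr0n.
move=> n; rewrite cond_word_entropyB.
rewrite wsum_ge0 /= => [|z _]; last exact: info_increment_ge0.
apply: le_trans (ler_wsum (fun z _ => info_increment_le z)) _.
have -> : wsum n (fun z => (\sum_(x : A)
      excess (fwd M (fwd_step M pi x) z) (fwd M pi z)) / ln 2) =
    (\sum_(x : A) wsum n (fun z =>
      excess (fwd M (fwd_step M pi x) z) (fwd M pi z))) / ln 2.
  rewrite -wsum_sum mulrC -wsumZ; apply: eq_wsum => z _.
  by rewrite mulrC.
rewrite mulrAC ler_pM2r ?invr_gt0 ?ln2_gt0 //.
apply: (@le_trans _ _ (\sum_(x : A) c * alpha ^+ n)).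
  apply: ler_sum => x _.
  apply: le_trans (dec n _ _ (fwd_step_le_stationary x)) _.
  by case: statpi => _; rewrite /mass => ->; rewrite mulr1.
have a0 : 0 <= alpha by case/andP: alpha01 => /ltW.
rewrite sumr_const -[_ *+ _]mulr_natr mulrAC ler_wpM2r ?exprn_ge0 //.
by rewrite ler_wpM2l ?(ltW c0) // ler_nat.
Qed.

End EntropyIncrements.

(** * Real sequences with geometrically small decrements *)

Section GeometricDecrements.
Context {R : realType}.
Implicit Types b : nat -> R.

Lemma geometric_decrements_cvg b (c alpha : R) : 0 < c -> 0 < alpha < 1 ->
  (forall n, 0 <= b n - b n.+1 <= c * alpha ^+ n) ->
  exists2 l, b @ \oo --> l &
    forall n, 0 <= b n - l <= c / (1 - alpha) * alpha ^+ n.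
Proof.
move=> c0 /andP[a0 a1] dec; have a10 : 0 < 1 - alpha by rewrite subr_gt0.
pose K := c / (1 - alpha).
have K0 : 0 < K by rewrite divr_gt0.
have cK : c = K * (1 - alpha) by rewrite divfK ?gt_eqF.
have bdec : nonincreasing_seq b.
  by apply/nonincreasing_seqP => n; rewrite -subr_ge0; case/andP: (dec n).
(* The decrements telescope to a finite geometric sum. *)
have lb n m : b n - b (n + m)%N <= K * alpha ^+ n * (1 - alpha ^+ m).
  elim: m => [|m IH]; first by rewrite addn0 subrr subrr mulr0.
  have /andP[_ d] := dec (n + m)%N.
  rewrite addnS exprS; move: d; rewrite cK exprD => d.
  have := lerD IH d; congr (_ <= _); ring.
have lb' n m : b n - K * alpha ^+ n <= b (n + m)%N.
  rewrite lerBlDr -lerBlDl (le_trans (lb n m)) // ler_piMr //.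
    by rewrite mulr_ge0 ?exprn_ge0 ?(ltW K0) ?(ltW a0).
  by rewrite gerBl exprn_ge0 // ltW.
have bcvg : cvgn b.
  apply: nonincreasing_is_cvgn => //; exists (b 0%N - K * alpha ^+ 0).
  by move=> _ [m _ <-]; have := lb' 0%N m.
exists (limn b) => // n; rewrite subr_ge0 nonincreasing_cvgn_ge //=.
rewrite -/K lerBlDr -lerBlDl; apply: limr_ge => //.
by exists n => // m /= nm; rewrite -(subnKC nm).
Qed.

Lemma limn_esup_root_lt1 (y : nat -> R) (c alpha : R) : 0 < c ->
  0 < alpha < 1 -> (forall n, 0 <= y n.+1 <= c * alpha ^+ n) ->
  (limn_esup (fun t : nat => (y t `^ (t%:R^-1))%:E) < 1%:E)%E.
Proof.
move=> c0 /andP[a0 a1] yb.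
(* A rate strictly above [alpha] absorbs the constant: eventually
   [c * alpha ^+ n <= beta ^+ n.+1]. *)
have [beta [b0 b1 ab]] : exists beta, [/\ 0 < beta, beta < 1 & alpha < beta].
  by exists ((1 + alpha) / 2); split; lra.
have [N _ HN] : \forall n \near \oo, (c / beta) * (alpha / beta) ^+ n < 1.
  have /cvgrPdist_lt/(_ _ ltr01) : (fun n => (c / beta) * (alpha / beta) ^+ n) @ \oo --> (0 : R).
    apply: (@cvg_geometric R (c / beta) (alpha / beta)).
    by rewrite gtr0_norm ?divr_gt0 // ltr_pdivrMr // mul1r.
  apply: filterS => n; rewrite sub0r normrN; apply: le_lt_trans.
  exact: ler_norm.
apply: (@le_lt_trans _ _ beta%:E); last by rewrite lte_fin.
rewrite /limn_esup /limf_esup.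
(* The upper limit is at most the supremum over the tail [N < t], which also excludes [t = 0], where
   [y] is not controlled. *)
apply: (@le_trans _ _ (ereal_sup ((fun t : nat => (y t `^ (t%:R^-1))%:E) @`
    [set t | (N < t)%N]))).
  by apply: ereal_inf_lbound; exists [set t | (N < t)%N] => //; exists N.+1.
apply: ge_ereal_sup => _ [[//|t] /= Nt <-]; rewrite lee_fin.
have /andP[y0 yt] := yb t.
have -> : beta = (beta ^+ t.+1) `^ (t.+1%:R^-1).
  by rewrite -powR_mulrn ?(ltW b0) // -powRrM mulfV ?pnatr_eq0 // powRr1 // ltW.
apply: ge0_ler_powR; rewrite ?nnegrE ?exprn_ge0 ?(ltW b0) ?invr_ge0 //.
apply: le_trans yt _.
have := HN t Nt; rewrite expr_div_n mulf_div ltr_pdivrMr ?mulr_gt0 ?exprn_gt0 //.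
by rewrite mul1r -exprS => /ltW.
Qed.

(** [e t / t] is a Cesàro mean of [b]; the index is shifted because [arithmetic_mean] at [n]
    averages the first [n.+1] terms. *)
Lemma cesaro_limn (b e : nat -> R) (l : R) : b @ \oo --> l ->
  (forall n, e n = \sum_(0 <= k < n) b k) ->
  limn (fun t : nat => e t / t%:R) = l.
Proof.
move=> /cesaro bl eE; apply: cvg_lim => //; rewrite -cvg_shiftS.
apply: cvg_trans bl; apply: near_eq_cvg; near=> n.
by rewrite /= eE /arithmetic_mean /series /= mulrC.
Unshelve. all: by end_near. Qed.

End GeometricDecrements.

(** * The joint law summed over state paths *)

Section PathSums.
Context {R : realType} {S A : finType} (M : hmm R S A).

Definition ffun_cons (I : Type) n (a : I) (s : {ffun 'I_n -> I}) :
    {ffun 'I_n.+1 -> I} :=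
  [ffun i => oapp s a (unlift ord0 i)].

Lemma ffun_cons0 (I : Type) n (a : I) (s : {ffun 'I_n -> I}) :
  ffun_cons a s ord0 = a.
Proof. by rewrite ffunE unlift_none. Qed.

Lemma ffun_consS (I : Type) n (a : I) (s : {ffun 'I_n -> I}) k :
  ffun_cons a s (lift ord0 k) = s k.
Proof. by rewrite ffunE liftK. Qed.

Lemma sum_ffun_cons (I : finType) n (F : {ffun 'I_n.+1 -> I} -> R) :
  \sum_s F s = \sum_(s' : {ffun 'I_n -> I}) \sum_(a : I) F (ffun_cons a s').
Proof.
rewrite pair_bigA (reindex (fun p => ffun_cons p.2 p.1)) //=.
exists (fun s : {ffun 'I_n.+1 -> I} => ([ffun k => s (lift ord0 k)], s ord0)).
  move=> [s a] _ /=; rewrite ffun_cons0; congr (_, _).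
  by apply/ffunP => k; rewrite ffunE ffun_consS.
move=> s _ /=; apply/ffunP => i; rewrite ffunE.
by case: unliftP => [k|] -> //=; rewrite ffunE.
Qed.

Lemma lift0_inord n k : (k < n.+1)%N ->
  inord k.+1 = lift ord0 (inord k : 'I_n.+1) :> 'I_n.+2.
Proof. by move=> kn; apply: val_inj; rewrite /= /bump /= !inordK. Qed.

Lemma inord0 n : inord 0 = ord0 :> 'I_n.+1.
Proof. by apply: val_inj; rewrite /= inordK. Qed.

(** Induction on the word: summing out the initial state absorbs the first transition and emission
    into the new initial vector [fwd_step M mu x]. *)
Lemma sum_paths_fwd (x0 : A) (w : seq A) (mu : S -> R) n j : size w = n ->
  \sum_(s : {ffun 'I_n.+1 -> S} | s ord_max == j)
    mu (s ord0) * \prod_(k < n) (hmm_T M (s (inord k)) (s (inord k.+1)) *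
                                 hmm_O M (s (inord k.+1)) (nth x0 w k)) =
  fwd M mu w j.
Proof.
elim: n w mu => [|n IH] [|x w] mu //=; last case.
  move=> _; rewrite big_mkcond sum_ffun_cons.
  have E (s' : {ffun 'I_0 -> S}) (a : S) : (if ffun_cons a s' ord_max == j
      then mu (ffun_cons a s' ord0) * \prod_(k < 0)
        (hmm_T M (ffun_cons a s' (inord k)) (ffun_cons a s' (inord k.+1)) *
         hmm_O M (ffun_cons a s' (inord k.+1)) (nth x0 [::] k)) else 0) =
      if a == j then mu j else 0.
    rewrite (_ : ord_max = ord0); last exact: val_inj.
    by rewrite ffun_cons0 big_ord0 mulr1; case: eqP => [->|].
  under eq_bigr => s' _ do
    (under eq_bigr => a _ do rewrite E; rewrite -big_mkcond big_pred1_eq).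
  by rewrite sumr_const card_ffun card_ord expn0.
move=> sw; rewrite -(IH w (fwd_step M mu x) sw).
rewrite big_mkcond sum_ffun_cons [RHS]big_mkcond; apply: eq_bigr => s _ /=.
have smax a : ffun_cons a s ord_max = s ord_max.
  by rewrite (_ : ord_max = lift ord0 ord_max) ?ffun_consS //; apply: val_inj.
under eq_bigr => a _ do rewrite smax.
case: eqP => _; last by rewrite big1.
rewrite /fwd_step mulr_suml; apply: eq_bigr => a _.
rewrite ffun_cons0 big_ord_recl /= lift0_inord // !inord0 ffun_cons0 ffun_consS.
rewrite mulrA; congr (_ * _); apply: eq_bigr => k _.
have kn := ltn_ord k.
by rewrite /bump /= add1n !lift0_inord ?ffun_consS // ltnS // ltnW.
Qed.

(** By distributivity the sum factors over positions; the letter at position 0 is free, and its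
    factor is a row sum of [hmm_O], equal to 1. *)
Lemma sum_emissions n (s : {ffun 'I_n.+1 -> S}) (w : n.-tuple A) :
  \sum_(x : {ffun 'I_n.+1 -> A} | [forall k : 'I_n, x (lift ord0 k) == tnth w k])
    \prod_(k < n.+1) hmm_O M (s k) (x k) =
  \prod_(k < n) hmm_O M (s (lift ord0 k)) (tnth w k).
Proof.
pose Q (i : 'I_n.+1) : pred A :=
  oapp (fun k => pred1 (tnth w k)) predT (unlift ord0 i).
transitivity (\prod_(i < n.+1) \sum_(y | Q i y) hmm_O M (s i) y).
  rewrite bigA_distr_big_dep; apply: eq_bigl => x.
  apply/forallP/familyP => H i.
    by rewrite /Q; case: unliftP => [k ->|_] //=; apply: H.
  by have := H (lift ord0 i); rewrite /Q liftK.
rewrite big_ord_recl /Q unlift_none /= hmm_O_sum1 mul1r.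
by apply: eq_bigr => k _; rewrite liftK /= big_pred1_eq.
Qed.

Lemma sum_hmm_law_fwd mu n (w : n.-tuple A) j :
  \sum_(s : {ffun 'I_n.+1 -> S} | s ord_max == j)
  \sum_(x : {ffun 'I_n.+1 -> A} | [forall k : 'I_n, x (lift ord0 k) == tnth w k])
    hmm_law M mu s x = fwd M mu w j.
Proof.
(* A default letter for [nth]; the alphabet is nonempty since state [j] emits something. *)
have [x0 _] := exists_emission M j.
rewrite -(@sum_paths_fwd x0 w mu n) ?size_tuple //; apply: eq_bigr => s _.
rewrite /hmm_law -mulr_sumr sum_emissions -mulrA -big_split /=.
congr (_ * _); apply: eq_bigr => k _.
rewrite -tnth_nth; congr (_ * hmm_O M (s _) _).
by apply: val_inj; rewrite /= inordK // ltnS.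
Qed.

Lemma mergeable_word : path_mergeable M ->
  forall i j, exists w k, 0 < word_mx M w i k /\ 0 < word_mx M w j k.
Proof.
move=> mrg i j; have [<-|ij] := eqVneq i j.
  by exists [::], i; rewrite /word_mx /= eqxx.
have [n [w [k]]] := mrg i j ij; rewrite !inE /word_state_prob !sum_hmm_law_fwd.
by move=> /andP[wi wj]; exists w, k.
Qed.

End PathSums.

(** * From the process on a probability space to word probabilities *)

Section ProcessLaw.
Context {R : realType} {d : measure_display} {Omega : measurableType d}.
Context (P : probability Omega R).

Lemma pr_preimage (I : finType) (Z : Omega -> I) (Q : pred I) :
  (forall i, measurable (Z @^-1` [set i])) ->
  pr P [set omega | Q (Z omega)] = \sum_(i | Q i) pr P (Z @^-1` [set i]).
Proof.
move=> mZ; pose r := [seq i <- enum I | Q i].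
have -> : [set omega | Q (Z omega)] =
    \bigcup_(i in [set` r]) Z @^-1` [set i].
  apply/seteqP; split => [w /= Qw|w [i /=]]; last first.
    by rewrite mem_filter => /andP[Qi _] ->.
  by exists (Z w) => //=; rewrite mem_filter Qw mem_enum.
rewrite /pr measure_fin_bigcup //; last first.
  by move=> i j _ _ [w [/= <- <-]].
rewrite -fsbig_seq; last by rewrite filter_uniq ?enum_uniq.
rewrite big_filter big_enum_cond /= -sum_fine // => i _.
exact: fin_num_measure.
Qed.

Context {S A : finType} (M : hmm R S A) (pi : S -> R).
Context (St : nat -> Omega -> S) (X : nat -> Omega -> A).
Hypothesis procX : hmm_process P M pi St X.

(** The event is a finite disjoint union of atoms of the joint law of states and outputs up to time
    [n]; grouping them by the last state gives the entries of the forward vector. *)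
Lemma pr_block n (w : n.-tuple A) :
  pr P (block X n @^-1` [set w]) = word_pr M pi w.
Proof.
have [mS mX lawX] := procX.
pose Z omega : {ffun 'I_n.+1 -> S} * {ffun 'I_n.+1 -> A} :=
  ([ffun k : 'I_n.+1 => St k omega], [ffun k : 'I_n.+1 => X k omega]).
have ZE s x : Z @^-1` [set (s, x)] =
    [set omega | forall k : 'I_n.+1, St k omega = s k /\ X k omega = x k].
  apply/seteqP; split => [omega /= [<- <-] k|omega /= H].
    by rewrite !ffunE.
  by congr (_, _); apply/ffunP => k; rewrite ffunE; case: (H k).
have mZ p : measurable (Z @^-1` [set p]).
  case: p => s x; rewrite ZE.
  have -> : [set omega | forall k : 'I_n.+1, St k omega = s k /\ X k omega = x k] =
      \bigcap_(k in [set: 'I_n.+1])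
        (St k @^-1` [set s k] `&` X k @^-1` [set x k]).
    by apply/seteqP; split => [omega H k _|omega H k]; exact: H.
  apply: fin_bigcap_measurable => [|k _]; first exact: finite_finset.
  exact: measurableI.
pose Q (p : {ffun 'I_n.+1 -> S} * {ffun 'I_n.+1 -> A}) :=
  [forall k : 'I_n, p.2 (lift ord0 k) == tnth w k].
have -> : block X n @^-1` [set w] = [set omega | Q (Z omega)].
  apply/seteqP; split => [omega /= wE|omega /forallP H].
    by apply/forallP => k; rewrite ffunE -wE tnth_mktuple.
  apply: eq_from_tnth => k; rewrite tnth_mktuple.
  by have /eqP := H k; rewrite ffunE.
rewrite pr_preimage // /word_pr /mass.
under [RHS]eq_bigr => j _ do rewrite -sum_hmm_law_fwd.
rewrite -(partition_big (fun s : {ffun 'I_n.+1 -> S} => s ord_max) xpredT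
  (P := xpredT)) //=.
rewrite pair_big_dep /=; apply: eq_bigr => -[s x] _.
by rewrite ZE /pr lawX.
Qed.

Lemma block_rcons n omega :
  tval (block X n.+1 omega) = rcons (block X n omega) (X n.+1 omega).
Proof.
have E m : tval (block X m omega) = mkseq (fun k => X k.+1 omega) m.
  by rewrite /= /mkseq -val_enum_ord -map_comp.
by rewrite !E mkseqS.
Qed.

Lemma pr_next_block n (z : n.-tuple A) y :
  pr P (X n.+1 @^-1` [set y] `&` block X n @^-1` [set z]) =
  word_pr M pi (rcons z y).
Proof.
rewrite -(pr_block [tuple of rcons z y]); congr (pr P _).
apply/seteqP; split => [omega /= [<- <-]|omega /= /(congr1 val) /=].
  by apply: val_inj; exact: block_rcons.
move=> H; have : rcons (block X n omega) (X n.+1 omega) = rcons z y.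
  by rewrite -block_rcons; exact: H.
by move=> /rcons_inj[zE yE]; split => //; apply: val_inj.
Qed.

Hypothesis statpi : stationary M pi.

Lemma entropy_block n : entropy P (block X n) = word_entropy M pi n.
Proof.
rewrite /entropy /word_entropy -sum_tuple_wsum; congr (- _).
by apply: eq_bigr => z _; rewrite pr_block.
Qed.

Lemma block_estimateE n : block_estimate P X n.+1 = cond_word_entropy M pi n.
Proof.
rewrite /block_estimate /cond_entropy /cond_word_entropy -sum_tuple_wsum.
rewrite -sumrN; apply: eq_bigr => z _; rewrite mulrN; congr (- _).
rewrite mulr_sumr; apply: eq_bigr => y _.
rewrite /cond_pr pr_block pr_next_block mulrA; congr (_ * _).
(* For a null word [z] the quotient is 0 by convention, and so is the probability of its extension
   by [y]. *)
have := word_pr_ge0 statpi z; rewrite le_eqVlt => /predU1P[pz|pz].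
  rewrite -pz mul0r; apply/le_anti; rewrite word_pr_ge0 //=.
  by rewrite pz word_pr_rcons_le.
by rewrite mulrC divfK ?gt_eqF.
Qed.

End ProcessLaw.

Theorem mainTheorem4 (R : realType) (S A : finType) (M : hmm R S A)
    (irrM : irreducible M) (mergeM : path_mergeable M)
    (pi : S -> R) (statpi : stationary M pi)
    (d : measure_display) (Omega : measurableType d) (P : probability Omega R)
    (St : nat -> Omega -> S) (X : nat -> Omega -> A)
    (procX : hmm_process P M pi St X) :
  (limn_esup (fun t : nat =>
     ((block_estimate P X t - entropy_rate P X) `^ (t%:R^-1))%:E) < 1%:E)%E.
Proof.
have [c [alpha [c0 alpha01 dec]]] :=
  cond_word_entropy_decrements statpi irrM (mergeable_word mergeM).
have [h bh hb] := geometric_decrements_cvg c0 alpha01 dec.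
have -> : entropy_rate P X = h.
  apply: (cesaro_limn bh) => n.
  by rewrite (entropy_block procX) (word_entropyE statpi).
have /andP[_ a1] := alpha01.
(* The bound at [n] concerns $h(n+1)$, which matches the shift in [limn_esup_root_lt1]. *)
apply: (limn_esup_root_lt1 (c := c / (1 - alpha)) _ alpha01) => [|n].
  by rewrite divr_gt0 // subr_gt0.
by rewrite (block_estimateE procX statpi).
Qed.
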